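(* Let $G$ be a graph of order $n$ with largest Seidel eigenvalue $2\theta-1$. Let $r=\operatorname{rank}(S(G)-(2\theta-1)\mathbf{I})$. Assume that $n=\frac{r(r+1)}{2}$. Then $G$ is strongly maximal.
   Context: All graphs are finite, simple, undirected, without loops. The Seidel matrix of a graph $G$ is $S(G)=\mathbf{J}-\mathbf{I}-2A(G)$, where $A(G)$ is the adjacency matrix, $\mathbf{J}$ the all-ones matrix and $\mathbf{I}$ the identity matrix; equivalently, a Seidel matrix is a symmetric matrix with zero diagonal and all off-diagonal entries $\pm1$. Seidel eigenvalues of $G$ are the eigenvalues of $S(G)$. A Seidel matrix $S$ with largest eigenvalue $\lambda$ is strongly maximal if there is no Seidel matrix $S'$ such that the largest eigenvalue of $S'$ equals $\lambda$ and $S'$ contains $S$ as a proper principal submatrix. A graph $G$ is strongly maximal if $S(G)$ is. *)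

(* Defs.v *)
From HB Require Import structures.
From mathcomp Require Import all_boot all_order all_algebra.

Set Implicit Arguments.
Unset Strict Implicit.
Unset Printing Implicit Defensive.

Import Order.TTheory GRing.Theory Num.Theory.
Local Open Scope ring_scope.

Record sgraph (n : nat) := SGraph {
  adj : rel 'I_n;
  adj_sym : symmetric adj;
  adj_irrefl : irreflexive adj
}.

Definition adj_mx (R : rcfType) (n : nat) (G : sgraph n) : 'M[R]_n :=
  \matrix_(i, j) (adj G i j)%:R.

Definition seidel_of (R : rcfType) (n : nat) (G : sgraph n) : 'M[R]_n :=
  const_mx 1 - 1%:M - 2%:R *: adj_mx R G.

Definition is_seidel (R : rcfType) (n : nat) (S : 'M[R]_n) : Prop :=
  [/\ S^T = S,
      forall i, S i i = 0
    & forall i j, i != j -> S i j = 1 \/ S i j = -1].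

(* [eigenvalue] ranges over R only; for symmetric S this is the whole spectrum,
   R being real closed.  No such [lam] exists when n = 0. *)
Definition largest_eigenvalue (R : rcfType) (n : nat) (S : 'M[R]_n) (lam : R)
  : Prop :=
  eigenvalue S lam /\ forall mu : R, eigenvalue S mu -> mu <= lam.

(* The selected indices may be listed in any order (f is injective, not
   necessarily increasing). *)
Definition proper_principal_submx (R : rcfType) (n m : nat)
    (S : 'M[R]_n) (S' : 'M[R]_m) : Prop :=
  (n < m)%N /\ exists f : 'I_n -> 'I_m, injective f /\ S = mxsub f f S'.

Definition strongly_maximal_mx (R : rcfType) (n : nat) (S : 'M[R]_n) : Prop :=
  is_seidel S /\
  exists lam : R, largest_eigenvalue S lam /\
    ~ exists (m : nat) (S' : 'M[R]_m),
        [/\ is_seidel S', largest_eigenvalue S' lam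
          & proper_principal_submx S S'].

Definition strongly_maximal (R : rcfType) (n : nat) (G : sgraph n) : Prop :=
  strongly_maximal_mx (seidel_of R G).

(* Main.v *)
Require Import Defs.
From mathcomp Require Import all_boot all_order all_algebra.
From mathcomp Require Import complex ring lra.
Set Implicit Arguments.
Unset Strict Implicit.
Unset Printing Implicit Defensive.
Import Order.TTheory GRing.Theory Num.Theory.
Local Open Scope ring_scope.
Local Open Scope sesquilinear_scope.

(** Write [lam = 2 * theta - 1] and [M = lam * I - S].  As [lam] is the largest
    eigenvalue, [M] is positive semidefinite of rank [r], hence the Gram matrix
    of vectors [b_1, ..., b_n] spanning an [r]-dimensional space, with squared
    norm [lam] and pairwise inner products [+1] or [-1]: a system of
    equiangular lines.  Once [1 < lam], the matrix of squared inner products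
    is [(lam ^ 2 - 1) * I + J], which is positive definite, so the symmetric
    matrices [b_i b_i^T] are linearly independent.  There are
    [n = r (r + 1) / 2] of them, the equality case of Gerzon's bound, so they
    form a basis of the space of symmetric [r] x [r] matrices
    ([symmetric_span_rank1]).

    Suppose a Seidel matrix with the same largest eigenvalue has [S] as a
    proper principal submatrix, and take the vector of one extra index.  Let
    [p] be its orthogonal projection onto the span of the [b_i]; the extended
    Gram matrix being positive semidefinite, such a projection exists
    ([psdmx_congr_range]).  All its inner products with the [b_i] are [+1] or
    [-1], so [lam * p p^T] and the identity have the same pairing, [lam], with
    every [b_i b_i^T].  These matrices span, whence [lam * p p^T] is the
    identity ([gerzon_equality_rank1]) and [r <= 1].

    On the other hand [lam] is an eigenvalue of [S], so that
    [r < n = r (r + 1) / 2], which forces [2 <= r].  Then also [1 < lam]: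
    two indices already give [1 <= lam], and for [lam = 1] all the
    [b_i] are parallel, so again [r <= 1].

    Square roots of matrices are avoided by keeping the inner product of the
    [r]-dimensional space as a symmetric matrix [N], with [M = B^T N B]. *)

(** * Positive semidefinite matrices *)

Definition psdmx (R : rcfType) (n : nat) (M : 'M[R]_n) : Prop :=
  M^T = M /\ forall w : 'rV_n, 0 <= (w *m M *m w^T) 0 0.

(** The spectral theorem is applied over the algebraic closure [R[i]]: there
    [S] is Hermitian, its diagonal entries in a unitary eigenbasis are real,
    hence eigenvalues of [S] over [R], and the quadratic form of
    [lam%:M - S] becomes a combination of squared norms with nonnegative
    coefficients. *)
Lemma symmetric_psdmx (R : rcfType) (n : nat) (S : 'M[R]_n) (lam : R) :
  S^T = S -> (forall mu, eigenvalue S mu -> mu <= lam) -> psdmx (lam%:M - S).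
Proof.
move=> symS le_lam; split; first by rewrite linearB /= tr_scalar_mx symS.
move=> w.
pose toC := real_complex R.
have conj_toC x : (toC x)^* = toC x by apply: conjc_real.
pose A := map_mx toC S.
have hermA : A \is hermsymmx.
  apply/is_hermitianmxP; rewrite expr0 scale1r; apply/matrixP=> i j.
  rewrite !mxE conj_toC; congr toC.
  by rewrite -[in LHS]symS mxE.
have /orthomx_spectralP := hermitian_normalmx hermA.
have realD := hermitian_spectral_diag_real hermA.
have unitP := spectral_unit A.
have := spectral_unitarymx A.
set P := spectralmx A in unitP *; set D := spectral_diag A in realD *.
move=> unitaryP defA.
have le_D i : D 0 i <= toC lam.
  have realDi : D 0 i = toC (complex.Re (D 0 i)).
    have /mxOverP/(_ 0 i) := realD; rewrite -/D.
    by case: (D 0 i) => a b /=; rewrite complex_real => /eqP->.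
  have : eigenvalue A (D 0 i).
    apply/eigenvalueP; exists (row i P).
      rewrite {1}defA rowE !mulmxA mulmxK // -(rowE i (diag_mx D)).
      by rewrite row_diag_mx -scalemxAl -rowE.
    apply/eqP => /(congr1 (mulmx^~ (invmx P))).
    rewrite rowE mulmxK // mul0mx => /rowP/(_ i)/eqP.
    by rewrite !mxE !eqxx oner_eq0.
  rewrite eigenvalue_root_char realDi -map_char_poly fmorph_root.
  rewrite -eigenvalue_root_char => /le_lam.
  by rewrite lecR.
(* The coordinates of [w] in the eigenbasis formed by the rows of [P]. *)
pose y := map_mx toC w *m invmx P.
have conj_w : map_mx toC w^T = (map_mx toC w)^t*.
  by apply/matrixP => i j; rewrite !mxE conj_toC.
have defM : map_mx toC (lam%:M - S) = invmx P *m diag_mx (const_mx (toC lam) - D) *m P.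
  rewrite map_mxB map_scalar_mx -/A {1}defA.
  by rewrite linearB /= mulmxBr mulmxBl diag_const_mx scalar_mxC mulmxKV.
suff : toC 0 <= toC ((w *m (lam%:M - S) *m w^T) 0 0) by rewrite lecR.
rewrite [toC 0]rmorph0.
have -> : toC ((w *m (lam%:M - S) *m w^T) 0 0)
    = (y *m diag_mx (const_mx (toC lam) - D) *m y^t*) 0 0.
  transitivity (map_mx toC (w *m (lam%:M - S) *m w^T) 0 0); first by rewrite [RHS]mxE.
  rewrite !map_mxM defM conj_w /y trmx_mul map_mxM /= invmx_unitary //.
  have -> : (P^t*)^t* = P by apply/matrixP=> i j; rewrite !mxE conjCK.
  by rewrite !mulmxA.
rewrite mul_mx_diag mxE; apply: sumr_ge0 => i _; rewrite !mxE.
rewrite mulrAC -normCK mulr_ge0 ?exprn_ge0 ?subr_ge0 //.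
Qed.

(** Without a linear term there is nothing to prove; with one, a small step
    against its sign, of size [a / (c + 1)], makes the polynomial negative. *)
Lemma quadratic_ge0_linear_eq0 (R : realFieldType) (a c : R) :
  0 <= c -> (forall t, 0 <= 2%:R * t * a + t ^+ 2 * c) -> a = 0.
Proof.
move=> c_ge0 /(_ (- a / (c + 1))).
have c1_neq0 : c + 1 != 0 by lra.
have -> : 2%:R * (- a / (c + 1)) * a + (- a / (c + 1)) ^+ 2 * c
   = - (c + 2%:R) * (a / (c + 1)) ^+ 2 by field.
rewrite nmulr_rge0; last lra.
rewrite exprn_even_le0 //= mulf_eq0 invr_eq0 (negPf c1_neq0) orbF => /eqP->.
by [].
Qed.

(** An isotropic vector minimises the form, so the form has vanishing
    derivative there; moving in the direction [w *m M] shows that this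
    derivative is the squared norm of [w *m M]. *)
Lemma psdmx_isotropic (R : rcfType) (n : nat) (M : 'M[R]_n) (w : 'rV_n) :
  psdmx M -> (w *m M *m w^T) 0 0 <= 0 -> w *m M = 0.
Proof.
move=> [symM psdM] w_iso; set v := w *m M.
have entryD (A B : 'M[R]_1) : (A + B) 0 0 = A 0 0 + B 0 0 by rewrite mxE.
have entryZ t (A : 'M[R]_1) : (t *: A) 0 0 = t * A 0 0 by rewrite mxE.
have vMw : v *m M *m w^T = v *m v^T by rewrite -[LHS]mulmxA trmx_mul symM.
have norm_v : (v *m v^T) 0 0 = \sum_i v 0 i ^+ 2.
  by rewrite mxE; apply: eq_bigr => i _; rewrite [v^T _ _]mxE expr2.
have quad t : 0 <= 2%:R * t * (v *m v^T) 0 0 + t ^+ 2 * (v *m M *m v^T) 0 0.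
  have := psdM (w + t *: v).
  rewrite linearD linearZ /= !(mulmxDl, mulmxDr) -!(scalemxAl, scalemxAr).
  rewrite vMw -/v !(entryD, entryZ); lra.
have a0 := quadratic_ge0_linear_eq0 (psdM v) quad.
apply/rowP => i; rewrite [RHS]mxE; apply/eqP; rewrite -sqrf_eq0.
move/eqP: a0; rewrite norm_v psumr_eq0 => [/allP/(_ i)|j _]; last exact: sqr_ge0.
by rewrite mem_index_enum => /(_ isT).
Qed.

(** For Gram matrices this is the existence of orthogonal projections: the
    inner products of any vector with the selected ones are also those of some
    combination of the selected vectors.  Indeed a vector killed by
    [E *m M *m E^T] is isotropic for [M] after transport by [E]. *)
Lemma psdmx_congr_range (R : rcfType) (n m : nat) (M : 'M[R]_m)
    (E : 'M_(n, m)) :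
  psdmx M -> (M *m E^T <= E *m M *m E^T)%MS.
Proof.
move=> psdM; have [symM _] := psdM.
rewrite submxE; move: (cokermx _) (mulmx_coker (E *m M *m E^T)) => C kerC.
suff : C^T *m E *m M = 0.
  move/(congr1 trmx); rewrite !trmx_mul symM trmxK trmx0 mulmxA => ->.
  by rewrite eqxx.
apply/row_matrixP => i; rewrite row0 !row_mul.
apply: psdmx_isotropic => //; rewrite trmx_mul -tr_col trmxK.
suff -> : (col i C)^T *m E *m M *m (E^T *m col i C) = 0 by rewrite mxE.
rewrite [col i C]colE; set d := delta_mx _ _.
have -> A : A *m E *m M *m (E^T *m (C *m d)) = A *m ((E *m M *m E^T *m C) *m d).
  by rewrite !mulmxA.
by rewrite kerC mul0mx mulmx0.
Qed.

(** Two vectors of squared norm [lam] and inner product [M i j], of square 1: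
    Cauchy-Schwarz gives [1 <= lam], and its equality case makes them
    parallel.  Both come from the value [2 * (lam - 1)] of the form at
    [b_i - M i j * b_j]. *)
Lemma psdmx_row_dependent (R : rcfType) (n : nat) (M : 'M[R]_n) (lam : R) (i j : 'I_n) :
  psdmx M -> (forall k, M k k = lam) -> M i j ^+ 2 = 1 ->
  1 <= lam /\ (lam <= 1 -> row i M = M i j *: row j M).
Proof.
move=> psdM diagM Mij; have [symM ge0M] := psdM.
pose w : 'rV_n := delta_mx 0 i - M i j *: delta_mx 0 j.
have form_w : (w *m M *m w^T) 0 0 = 2%:R * (lam - 1).
  have -> : w *m M = row i M - M i j *: row j M.
    by rewrite mulmxBl -scalemxAl -!rowE.
  have -> : w^T = delta_mx i 0 - M i j *: delta_mx j 0.
    by rewrite linearB linearZ /= !trmx_delta.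
  rewrite mulmxBr -scalemxAr -!colE !mxE !diagM.
  have -> : M j i = M i j by rewrite -{1}symM mxE.
  ring: Mij.
split=> [|lam_le1]; first by have := ge0M w; rewrite form_w; lra.
have : w *m M = 0 by apply: psdmx_isotropic => //; rewrite form_w; lra.
by rewrite mulmxBl -scalemxAl -!rowE => /eqP; rewrite subr_eq0 => /eqP.
Qed.

Lemma psdmx_unit_rank_le1 (R : rcfType) (n : nat) (M : 'M[R]_n) :
  psdmx M -> (forall i, M i i = 1) -> (forall i j, i != j -> M i j ^+ 2 = 1) ->
  (\rank M <= 1)%N.
Proof.
case: n M => [|n] M psdM diagM offM; first by rewrite (leq_trans (rank_leq_row _)).
apply: leq_trans (rank_leq_row (row 0 M)); apply/mxrankS/row_subP => i.
have Mi0 : M i 0 ^+ 2 = 1.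
  by have [->|/offM//] := eqVneq i 0; rewrite diagM expr1n.
have [_ ->//] := psdmx_row_dependent psdM diagM Mi0.
by rewrite scalemx_sub.
Qed.

(** * Symmetric matrices and Gerzon's bound *)

(** A Gram factorization of [M] through a space of dimension [\rank M] whose
    symmetric form [N] is not normalised to the identity; this makes sense over
    every field. *)
Lemma symmetric_rank_factor (F : fieldType) (n : nat) (M : 'M[F]_n) :
  M^T = M ->
  exists B : 'M_(\rank M, n), exists2 N : 'M_(\rank M), N^T = N & M = B^T *m N *m B.
Proof.
move=> symM; have leMB : (M <= row_base M)%MS by rewrite eq_row_base.
move: (row_base M) leMB => B /mulmxKpV.
move: (pinvmx B) => P MPB; exists B; exists (P^T *m M *m P).
  by rewrite !trmx_mul trmxK symM mulmxA.
have -> : B^T *m (P^T *m M *m P) *m B = (M *m P *m B)^T *m P *m B.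
  by rewrite !trmx_mul symM !mulmxA.
by rewrite MPB symM MPB.
Qed.

Lemma card_le_pairs (r : nat) :
  #|[pred p : 'I_r * 'I_r | (p.1 <= p.2)%N]| = ((r * (r + 1)) %/ 2)%N.
Proof.
rewrite -sum1_card -(pair_big_dep xpredT (fun i j : 'I_r => (i <= j)%N) (fun _ _ => 1%N)) /=.
rewrite (exchange_big_dep xpredT) //=.
have -> : ((r * (r + 1)) %/ 2)%N = 'C(r.+1, 2) by rewrite bin2 -divn2 /= addn1 mulnC.
rewrite -bin2_sum big_mkord big_ord_recl add0n; apply: eq_bigr => j _.
by rewrite -(big_ord_widen r (fun=> 1%N) (ltn_ord j)) sum_nat_const card_ord muln1.
Qed.

Lemma symmetric_eq_le (F : Type) (r : nat) (X Y : 'M[F]_r) :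
  X^T = X -> Y^T = Y -> (forall a b : 'I_r, (a <= b)%N -> X a b = Y a b) -> X = Y.
Proof.
move=> symX symY eqXY; apply/matrixP => a b.
have [|/ltnW] := leqP a b => le_ab; first exact: eqXY.
by rewrite -symX -symY !mxE eqXY.
Qed.

(** A symmetric matrix is determined by its entries on and above the diagonal.
    These entries embed the independent family of the [b_i b_i^T], for [b_i]
    the columns of [B], as the rows of a matrix that is square because of the
    value of [n]; so this matrix is invertible and the family spans. *)
Lemma symmetric_span_rank1 (F : fieldType) (r n : nat) (B : 'M[F]_(r, n)) :
  n = ((r * (r + 1)) %/ 2)%N ->
  (forall c : 'rV_n, B *m diag_mx c *m B^T = 0 -> c = 0) ->
  forall Y : 'M_r, Y^T = Y -> exists c : 'rV_n, Y = B *m diag_mx c *m B^T.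
Proof.
rewrite -card_le_pairs; set A := [pred p : 'I_r * 'I_r | _] => defn injB Y symY.
pose V := \matrix_(i < n, k < #|A|) (B (enum_val k).1 i * B (enum_val k).2 i).
have entryV (c : 'rV_n) k : (c *m V) 0 k
    = (B *m diag_mx c *m B^T) (enum_val k).1 (enum_val k).2.
  rewrite mul_mx_diag !mxE; apply: eq_bigr => i _; rewrite !mxE; ring.
have symB (c : 'rV_n) : (B *m diag_mx c *m B^T)^T = B *m diag_mx c *m B^T.
  by rewrite !trmx_mul trmxK tr_diag_mx mulmxA.
have det_by_V (c : 'rV_n) (X : 'M_r) : X^T = X ->
    (forall k, (c *m V) 0 k = X (enum_val k).1 (enum_val k).2) ->
    B *m diag_mx c *m B^T = X.
  move=> symX eqcX; apply: symmetric_eq_le => // a b le_ab.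
  have abA : (a, b) \in A by [].
  have := eqcX (enum_rank_in abA (a, b)).
  by rewrite entryV enum_rankK_in.
have fullV : row_full V.
  suff : row_free V by move=> /eqP rankV; apply/eqP; rewrite rankV.
  apply: inj_row_free => c cV0; apply/injB/det_by_V; first exact: trmx0.
  by move=> k; rewrite cV0 !mxE.
have /submxP[c defc] := submx_full (\row_k Y (enum_val k).1 (enum_val k).2) fullV.
by exists c; apply/esym/det_by_V => // k; rewrite -defc mxE.
Qed.

(** The equality case of Gerzon's bound for equiangular vectors, the columns of
    [B], in the space with symmetric form [N]: a vector [p] with the same
    angles to all of them can exist only if [N] has rank at most one.  The two sides
    have the same value on every [b_i], their difference is therefore
    orthogonal to every [b_i b_i^T], hence to all symmetric matrices, including
    itself. *)
Lemma gerzon_equality_rank1 (R : realFieldType) (r n : nat) (B : 'M[R]_(r, n)) (N : 'M_r)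
  (p : 'rV_r) (lam : R) :
  n = ((r * (r + 1)) %/ 2)%N -> 1 < lam -> N^T = N ->
  (forall i, (B^T *m N *m B) i i = lam) ->
  (forall i j, i != j -> (B^T *m N *m B) i j ^+ 2 = 1) ->
  (forall j, (p *m N *m B) 0 j ^+ 2 = 1) ->
  N = lam *: ((p *m N)^T *m (p *m N)).
Proof.
move=> defn lam_gt1 symN diagM offM pNB; set M := B^T *m N *m B in diagM offM.
have symM : M^T = M by rewrite /M !trmx_mul trmxK symN mulmxA.
have sqM i j : M i j ^+ 2 = (lam ^+ 2 - 1) *+ (i == j) + 1.
  have [<-|/offM->] := eqVneq i j; last by rewrite add0r.
  by rewrite diagM mulr1n subrK.
(* Pairing a dependency [c] with each [b_j b_j^T] gives the equations [cj];
   their combination with weights [c] is a vanishing sum of squares. *)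
have injB (c : 'rV_n) : B *m diag_mx c *m B^T = 0 -> c = 0.
  move=> Bc0; pose s := \sum_i c 0 i.
  have cj j : (lam ^+ 2 - 1) * c 0 j + s = 0.
    have : (M *m diag_mx c *m M) j j = 0.
      have -> : M *m diag_mx c *m M
        = B^T *m N *m (B *m diag_mx c *m B^T) *m (N *m B) by rewrite !mulmxA.
      by rewrite Bc0 mulmx0 mul0mx mxE.
    rewrite mul_mx_diag mxE => <-.
    rewrite (eq_bigr (fun i => (lam ^+ 2 - 1) * (c 0 i *+ (j == i)) + c 0 i)).
      rewrite big_split /= -mulr_sumr (bigD1 j) //= eqxx big1 ?addr0 // => i.
      by rewrite eq_sym => /negPf->.
    move=> i _; have -> : M i j = M j i by rewrite -{1}symM mxE.
    rewrite mxE.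
    rewrite mulrAC -expr2 sqM; case: (j == i); rewrite ?mulr0n ?mulr1n; ring.
  have : \sum_j ((lam ^+ 2 - 1) * c 0 j ^+ 2) + s ^+ 2 = 0.
    have -> : s ^+ 2 = \sum_j s * c 0 j by rewrite expr2 -mulr_sumr.
    rewrite -big_split big1 //= => j _.
    by rewrite expr2 mulrA -mulrDl cj mul0r.
  have lam2 : 0 < lam ^+ 2 - 1 by nra.
  have sq_ge0 j : true -> 0 <= (lam ^+ 2 - 1) * c 0 j ^+ 2.
    by move=> _; rewrite mulr_ge0 ?sqr_ge0 // ltW.
  move/eqP; rewrite paddr_eq0 ?sumr_ge0 ?sqr_ge0 // psumr_eq0 // => /andP[/allP c0 _].
  apply/rowP => j; rewrite [RHS]mxE; apply/eqP.
  by have := c0 j (mem_index_enum _); rewrite mulf_eq0 gt_eqF //= sqrf_eq0.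
pose X := lam *: ((p *m N)^T *m (p *m N)) - N.
have symX : X^T = X by rewrite linearB linearZ /= trmx_mul trmxK symN.
have BXB j : (B^T *m X *m B) j j = 0.
  rewrite mulmxBr mulmxBl -scalemxAr -scalemxAl -/M.
  have -> : B^T *m ((p *m N)^T *m (p *m N)) *m B = (p *m N *m B)^T *m (p *m N *m B).
    by rewrite [in RHS]trmx_mul !mulmxA.
  set q := p *m N *m B in pNB *.
  have -> : (lam *: (q^T *m q) - M) j j = lam * (q 0 j * q 0 j) - M j j.
    by rewrite !(mxE, big_ord1).
  by rewrite -expr2 pNB diagM mulr1 subrr.
have [c defX] := symmetric_span_rank1 defn injB symX.
have : \tr (X *m X^T) = 0.
  rewrite symX {2}defX !mulmxA mxtrace_mulC !mulmxA mul_mx_diag.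
  by rewrite /mxtrace big1 // => j _; rewrite mxE BXB mul0r.
have -> : \tr (X *m X^T) = \sum_a \sum_b X a b ^+ 2.
  by apply: eq_bigr => a _; rewrite mxE; apply: eq_bigr => b _; rewrite [X^T _ _]mxE.
have row_ge0 a : true -> 0 <= \sum_b X a b ^+ 2.
  by move=> _; apply: sumr_ge0 => b _; apply: sqr_ge0.
move/eqP; rewrite psumr_eq0 // => /allP X0.
suff : X = 0 by move/eqP; rewrite subr_eq0 => /eqP.
apply/matrixP => a b; rewrite [RHS]mxE; apply/eqP; rewrite -sqrf_eq0.
have := X0 a (mem_index_enum _); rewrite psumr_eq0 => [/allP|b' _]; last exact: sqr_ge0.
by move/(_ b (mem_index_enum _)).
Qed.

(** * Seidel matrices *)

Lemma eigenvalue_rank_lt (F : fieldType) (n : nat) (A : 'M[F]_n) (a : F) :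
  eigenvalue A a -> (\rank (A - a%:M)%R < n)%N.
Proof.
rewrite /eigenvalue /eigenspace -mxrank_eq0 mxrank_ker subn_eq0 -ltnNge.
by [].
Qed.

Lemma seidel_of_is_seidel (R : rcfType) (n : nat) (G : sgraph n) :
  is_seidel (seidel_of R G).
Proof.
split=> [|i|i j neq_ij].
- by apply/matrixP=> i j; rewrite !mxE eq_sym adj_sym.
- by rewrite !mxE adj_irrefl eqxx mulr0 subr0 subrr.
- rewrite !mxE (negPf neq_ij); case: (adj G i j); [right|left]; rewrite /= ?mulr1n ?mulr0n; ring.
Qed.

Lemma seidel_gram_diag (R : rcfType) (n : nat) (S : 'M[R]_n) (lam : R) i :
  is_seidel S -> (lam%:M - S) i i = lam.
Proof. by case=> _ S0 _; rewrite !mxE S0 eqxx subr0. Qed.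

Lemma seidel_gram_sqr (R : rcfType) (n : nat) (S : 'M[R]_n) (lam : R) i j :
  is_seidel S -> i != j -> (lam%:M - S) i j ^+ 2 = 1.
Proof.
case=> _ _ S1 neq_ij; rewrite !mxE (negPf neq_ij).
by case: (S1 i j neq_ij) => ->; rewrite sub0r sqrrN ?sqrrN expr1n.
Qed.

Lemma seidel_gram_psdmx (R : rcfType) (n : nat) (S : 'M[R]_n) (lam : R) :
  is_seidel S -> largest_eigenvalue S lam -> psdmx (lam%:M - S).
Proof. by case=> symS _ _ [_]; apply: symmetric_psdmx. Qed.

Theorem theorem5p5 (R : rcfType) (n : nat) (G : sgraph n) (theta : R) (r : nat)
  (htheta : largest_eigenvalue (seidel_of R G) (2%:R * theta - 1))
  (hr : r = \rank (seidel_of R G - (2%:R * theta - 1)%:M))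
  (hn : n = ((r * (r + 1)) %/ 2)%N) :
  strongly_maximal R G.
Proof.
have seidelS := seidel_of_is_seidel R G; split=> //.
exists (2%:R * theta - 1); split=> //.
move: (seidel_of R G) (_ - 1) seidelS htheta hr => S lam seidelS maxS.
rewrite -mxrank_opp opprB.
have [/eigenvalue_rank_lt] := maxS; rewrite -mxrank_opp opprB => lt_rank _.
set M := lam%:M - S in lt_rank * => hr.
move=> [m [S' [seidelS' maxS' [lt_nm [f [inj_f defS]]]]]].
rewrite -hr in lt_rank.
have r_gt1 : (1 < r)%N.
  by move: lt_rank; rewrite [in X in (_ < X)%N]hn; case: (r) => [|[|]].
have psdM : psdmx M by apply: seidel_gram_psdmx.
have diagM i : M i i = lam by apply: seidel_gram_diag.
have offM i j : i != j -> M i j ^+ 2 = 1 by apply: seidel_gram_sqr.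
have n_gt1 : (1 < n)%N by apply: ltn_trans lt_rank.
have lam_gt1 : 1 < lam.
  rewrite lt_neqAle; apply/andP; split; last first.
    have M01 : M (Ordinal (ltnW n_gt1)) (Ordinal n_gt1) ^+ 2 = 1 by apply: offM.
    by have [] := psdmx_row_dependent psdM diagM M01.
  apply: contraL r_gt1 => /eqP lam1; rewrite -leqNgt hr.
  by apply: psdmx_unit_rank_le1 => // i; rewrite diagM lam1.
have [k kNf] : exists k, k \notin codom f.
  apply/existsP; apply: contraLR lt_nm => /existsPn codf.
  rewrite -leqNgt -[m]card_ord -[n]card_ord -(card_codom inj_f).
  by apply/subset_leq_card/subsetP => k _; have := codf k; rewrite negbK.
pose M' := lam%:M - S'.
have psdM' : psdmx M' by apply: seidel_gram_psdmx.
(* Congruence by [E] extracts the principal submatrix selected by [f]. *)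
pose E : 'M[R]_(n, m) := rowsub f 1%:M.
have mulE l (A : 'M[R]_(l, m)) i j : (A *m E^T) i j = A i (f j).
  rewrite mxE (bigD1 (f j)) //= !mxE eqxx mulr1 big1 ?addr0 // => b.
  by rewrite eq_sym !mxE => /negPf->; rewrite mulr0.
have defM : M = E *m M' *m E^T.
  apply/matrixP => i j; rewrite mulE -rowsubE /M defS !mxE.
  by rewrite (inj_eq inj_f).
have : (row k (M' *m E^T) <= M)%MS.
  by rewrite (submx_trans (row_sub _ _)) // defM psdmx_congr_range.
case/submxP => q defq.
have [symM _] := psdM.
have := symmetric_rank_factor symM; rewrite -hr => -[B [N symN defN]].
(* [q *m B^T] represents the projection of the extra vector. *)
have pNB j : (q *m B^T *m N *m B) 0 j ^+ 2 = 1.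
  have -> : q *m B^T *m N *m B = row k (M' *m E^T) by rewrite defq defN !mulmxA.
  rewrite mxE mulE; apply: seidel_gram_sqr => //.
  by apply: contraNneq kNf => ->; apply: codom_f.
have defN1 : N = lam *: ((q *m B^T *m N)^T *m (q *m B^T *m N)).
  by apply: gerzon_equality_rank1 hn lam_gt1 symN _ _ pNB; rewrite -defN.
move: r_gt1; rewrite ltnNge hr {1}defN => /negP; apply.
apply: leq_trans (mxrankM_maxl _ _) _; apply: leq_trans (mxrankM_maxr _ _) _.
rewrite defN1 (leq_trans (mxrank_scale _ _)) //.
by apply: leq_trans (mxrankM_maxr _ _) (rank_leq_row _).
Qed.
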